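(* The locus generation algorithm (described in the context, in Variant A or Variant B, under the assumptions listed there) is independent of the clockwise or anticlockwise orientation of its complex detours: it produces the same real algebraic locus whether all complex detours are traversed anticlockwise or all are traversed clockwise.
   Context: **Setting.** In a geometric construction, choose an element whose movement is constrained to one dimension (the ''mover'', e.g. a line through a point, a point on a line, or a point on a circle) and a point whose position depends on the position of the mover (the ''tracer''). The tracer can be constructed from the mover (and possibly further elements) using only geometric operations that have an algebraic representation, so movement of the mover causes the tracer to move on a real plane algebraic curve. The motion of the mover is rationally parameterized by a time parameter $t$, which may take complex values. The coordinates $x$ and $y$ of the tracer then satisfy algebraic equations $g(t,x)=0$ and $h(t,y)=0$. A singularity is a point in time when part of the construction degenerates or when two possible choices of a dependent element coincide and become indistinguishable. The real algebraic locus produced by the algorithm consists of the real positions of the tracer that it reaches. **Locus generation algorithm.** Start at a non-singular initial time $t_0\in\mathbb{R}$ at which the position of the tracer is real-valued. 1. Let $s:=1$, $t:=t_0$. 2. Let $t':=t+s\cdot\varepsilon$ for some small step size $\varepsilon>0$. Let $c$ be the circle in the complex plane that has the segment between $t$ and $t'$ as its diameter. The time parameter takes a complex detour on this circle. 3. Let $t$ take a small step on $c$ in anticlockwise direction. (In the version with the reversed orientation, every such step is taken in clockwise direction, with the same choices of step sizes.) 4. Update the position of the mover according to its parameterization in $t$. 5. Update the rest of the construction; for ambiguous elements, use proximity between old and new positions of the elements to determine the right instance of the construction. 6. Proceed according to the variant: - *Variant A.* If $t$ is real-valued and the tracer has real-valued coordinates, the tracer has reached a point of the real plane algebraic locus.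 If in this case $t$ has ended up in its initial position on $c$, invert the direction of movement of the mover by setting $s:=-s$ (the orientation of the complex detours remains the same). If $t=t_0$, $s=1$, and the tracer has reached its initial position again, stop; otherwise go to step 2. If $t$ is not real-valued or the tracer does not have real-valued coordinates, go to step 3. - *Variant B.* If the tracer has real-valued coordinates (whether or not $t$ is real-valued, and even if $t$ has ended up in its initial position on $c$), it has reached a point of the real algebraic locus. Set $s=\dfrac{t-a}{|t-a|}$, where $a$ is the centre of $c$. If $t=t_0$ and the tracer has reached its initial position again, in the initial direction of movement of the time parameter, stop; otherwise go to step 2. If the tracer does not have real-valued coordinates, go to step 3. **Assumptions on the algorithm.** - $\varepsilon$ is always chosen small enough that the complex detours wind around at most one ramification point of a coordinate of the tracer, and only around ramification points at which the position of the tracer is real-valued. - The steps taken on the complex detours are small enough that the right instance of the construction can be chosen by proximity, i.e. the instance that results from analytic continuation of the coordinate functions of the elements of the construction along the complex detours. - The steps taken on the complex detours are small enough that no real position of the tracer is missed. **Assumptions on the locus.** Let $\mathcal{C}\colon f(x,y)=0$ be a plane algebraic curve containing the real algebraic locus. - $f(x,y)$ is irreducible. (If it is reducible, consider without loss of generality the irreducible component containing the starting point.) - $\mathcal{C}$ has a real connected component. (Otherwise the locus is not a real connected component of a real plane algebraic curve and the algorithm is not applicable.) *)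

(* Defs.v *)
(* [R[i]] has no topology of its own: [R[i]^o], the same type as a module over
   itself, carries the one of the modulus. *)
From HB Require Import structures.
From mathcomp Require Import all_boot all_order all_algebra.
From mathcomp Require Import all_classical all_reals all_analysis.
From mathcomp Require Import complex.
From mathcomp Require mpoly.
Import -(notations) mpoly.

Set Implicit Arguments.
Unset Strict Implicit.
Unset Printing Implicit Defensive.

Import Order.TTheory GRing.Theory Num.Theory.
Import numFieldNormedType.Exports.

Local Open Scope classical_set_scope.
Local Open Scope ring_scope.
Local Open Scope complex_scope.

(* Elements are listed in the order of the construction, and each one is given
   by finitely many coordinates. [elt j] is the element that coordinate [j]
   belongs to. The mover is parameterized by the rational functions
   [mnum j / mden j] of the time parameter, for [j] a coordinate of the mover
   (other values of [mnum], [mden] are irrelevant). Every other element is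
   subject to the real polynomial equations [op e = 0] in its own coordinates
   and those of earlier elements; a fixed element is a special case. *)
Record construction (R : realType) := Construction {
  ncoord : nat;
  nelt : nat;
  elt : 'I_ncoord -> 'I_nelt;
  mover : 'I_nelt;
  mnum : 'I_ncoord -> {poly R};
  mden : 'I_ncoord -> {poly R};
  mden_neq0 : forall j, elt j = mover -> mden j != 0;
  op : 'I_nelt -> seq (mpoly ncoord R);
  op_causal : forall e p, p \in op e ->
    forall m, m \in msupp p -> forall j, m j != 0%N -> (elt j <= e)%N;
  xc : 'I_ncoord;
  yc : 'I_ncoord;
  xc_neq_yc : xc != yc;
  tracer_coords : forall j, elt j = elt xc <-> (j = xc \/ j = yc);
  tracer_after_mover : (mover < elt xc)%N
}.

Definition position (R : realType) (K : construction R) := 'I_(ncoord K) -> R[i].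

Definition tracer (R : realType) (K : construction R) (z : position K) :
  R[i] * R[i] := (z (xc K), z (yc K)).

Definition tracer_real (R : realType) (K : construction R) (z : position K) : bool :=
  ((tracer z).1 \is Num.real) && ((tracer z).2 \is Num.real).

Definition evalC (R : realType) (p : {poly R}) (t : R[i]) : R[i] :=
  (map_poly (real_complex R) p).[t].

Definition element_ok (R : realType) (K : construction R) (t : R[i])
    (z : position K) (e : 'I_(nelt K)) : Prop :=
  if e == mover K then
    forall j, elt j = mover K ->
      evalC (mden j) t != 0 /\ z j = evalC (mnum j) t / evalC (mden j) t
  else forall p, p \in op e -> mmap (real_complex R) z p = 0.

Definition instance (R : realType) (K : construction R) (t : R[i])
    (z : position K) : Prop := forall e, element_ok t z e.

Definition eq_element (R : realType) (K : construction R) (e : 'I_(nelt K))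
    (z w : position K) : Prop := forall j, elt j = e -> z j = w j.

Definition analytic_at (R : realType) (f : R[i] -> R[i]) (p : R[i]) : Prop :=
  exists c : nat -> R[i], \forall u \near (p : R[i]^o),
    series (fun k => c k * (u - p) ^+ k : R[i]^o) @ \oo --> (f u : R[i]^o).

(* Near a non-singular time, the instances are given by finitely many analytic
   functions (no part of the construction degenerates), and two choices of an
   element that coincide at [t] are the same choice. *)
Definition nonsingular (R : realType) (K : construction R) (t : R[i]) : Prop :=
  exists (m : nat) (phi : 'I_m -> R[i] -> position K),
    [/\ forall k j, analytic_at (fun u => phi k u j) t,
        \forall u \near (t : R[i]^o), forall z : position K,
          instance u z <-> exists k, z =1 phi k u &
        forall e k l, eq_element e (phi k t) (phi l t) ->
          \forall u \near (t : R[i]^o), eq_element e (phi k u) (phi l u)].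

(* [g] is a polynomial in the second variable with coefficients in [R[t]]. *)
Definition eval2C (R : realType) (g : {poly {poly R}}) (t x : R[i]) : R[i] :=
  (map_poly (map_poly (real_complex R)) g).[x%:P].[t].

Definition tracer_algebraic (R : realType) (K : construction R) : Prop :=
  exists g h : {poly {poly R}}, [/\ g != 0, h != 0 &
    forall t (z : position K), nonsingular K t -> instance t z ->
      eval2C g t (tracer z).1 = 0 /\ eval2C h t (tracer z).2 = 0].

(* [Phi s] is a germ at [gamma s]; neighbouring germs agree. *)
Definition continuation (R : realType) (K : construction R) (L : R)
    (gamma : R -> R[i]) (Phi : R -> R[i] -> position K) : Prop :=
  forall s, 0 <= s <= L ->
    (forall j, analytic_at (fun u => Phi s u j) (gamma s)) /\
    (\forall s' \near s, 0 <= s' <= L ->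
      \forall u \near (gamma s' : R[i]^o), Phi s' u =1 Phi s u).

(* The tracer, continued from its germ [T] at [t] inside the closed disc with
   centre [a] and radius [r], has the Puiseux parameterization
   time = tau + w ^ n, tracer = [P w], for 0 < |w| < d, and this is not a
   function of the time alone. A pole at [tau] is not excluded. *)
Definition ramifies (R : realType) (K : construction R) (a : R[i]) (r : R)
    (t : R[i]) (T : R[i] -> position K) (tau : R[i])
    (P : R[i] -> R[i] * R[i]) : Prop :=
  `|tau - a| < r%:C /\
  exists (gamma : R -> R[i]) (Phi : R -> R[i] -> position K) (n : nat)
         (d w0 : R[i]),
    [/\ [/\ {within `[0, 1], continuous (gamma : R -> R[i]^o)},
            gamma 0 = t &
            forall s, 0 <= s <= 1 -> `|gamma s - a| <= r%:C],
        continuation 1 gamma Phi /\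
          (\forall u \near (t : R[i]^o), Phi 0 u =1 T u),
        [/\ (0 < n)%N, 0 < `|w0| < d, gamma 1 = tau + w0 ^+ n &
            \forall w \near (w0 : R[i]^o), P w = tracer (Phi 1 (tau + w ^+ n))],
        forall w, 0 < `|w| < d ->
          analytic_at (fun u => (P u).1) w /\ analytic_at (fun u => (P u).2) w &
        exists w1 w2, [/\ 0 < `|w1| < d, 0 < `|w2| < d,
          w1 ^+ n = w2 ^+ n & P w1 <> P w2]].

Definition real_at_ramification (R : realType) (P : R[i] -> R[i] * R[i]) : Prop :=
  exists x y : R,
    ((fun w : R[i]^o => (P w).1 : R[i]^o) @ (0 : R[i]^o)^' --> (x%:C : R[i]^o)) /\
    ((fun w : R[i]^o => (P w).2 : R[i]^o) @ (0 : R[i]^o)^' --> (y%:C : R[i]^o)).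

Variant variant := VariantA | VariantB.
Variant orientation := Anticlockwise | Clockwise.

(* [fresh] means that the next step starts a new detour;
   [centre] and [origin] are the centre of the current circle and the initial
   position of [time] on it, and are only meaningful if [fresh] is false. *)
Record state (R : realType) (K : construction R) := State {
  time : R[i];
  dir : R[i];
  centre : R[i];
  origin : R[i];
  fresh : bool;
  pos : position K;
  halted : bool
}.

Definition initial_state (R : realType) (K : construction R) (t0 : R)
    (z0 : position K) : state K :=
  State t0%:C 1 t0%:C t0%:C true z0 false.

Definition unit_rotation (R : realType) (o : orientation) (theta : R) : R[i] :=
  match o with
  | Anticlockwise => cos theta +i* sin theta
  | Clockwise => cos theta +i* - sin theta
  end.

Definition detour_centre (R : realType) (K : construction R) (eps : R)
    (S : state K) : R[i] :=
  if fresh S then time S + dir S * (eps / 2)%:C else centre S.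

Definition detour_origin (R : realType) (K : construction R) (S : state K) : R[i] :=
  if fresh S then time S else origin S.

Definition arc (R : realType) (K : construction R) (o : orientation) (eps : R)
    (S : state K) (theta : R) : R[i] :=
  detour_centre eps S + (time S - detour_centre eps S) * unit_rotation o theta.

Definition hit (R : realType) (K : construction R) (v : variant) (t : R[i])
    (z : position K) : bool :=
  match v with
  | VariantA => (t \is Num.real) && tracer_real z
  | VariantB => tracer_real z
  end.

Definition new_dir (R : realType) (v : variant) (s t a b : R[i]) : R[i] :=
  match v with
  | VariantA => if t == b then - s else s
  | VariantB => (t - a) / `|t - a|
  end.

(* [z] is the new position of the elements. The test for stopping uses the
   updated direction: [s == 1] is the initial direction of movement. *)
Definition advance (R : realType) (K : construction R) (v : variant)
    (o : orientation) (t0 : R) (z0 : position K) (eps del : R) (S : state K)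
    (z : position K) : state K :=
  let a := detour_centre eps S in
  let b := detour_origin S in
  let t := arc o eps S del in
  let s := if hit v t z then new_dir v (dir S) t a b else dir S in
  State t s a b (hit v t z) z
    [&& hit v t z, t == t0%:C, s == 1 & tracer z == tracer z0].

Definition distance2 (R : realType) (K : construction R) (e : 'I_(nelt K))
    (z w : position K) : R :=
  \sum_(j | elt j == e) ComplexField.Normc.normc (z j - w j) ^+ 2.

(* The elements are updated in the order of the construction; given the new
   positions of the earlier ones, each takes the admissible position closest to
   its old one. *)
Definition chosen_by_proximity (R : realType) (K : construction R) (t : R[i])
    (zold znew : position K) : Prop :=
  instance t znew /\
  forall (e : 'I_(nelt K)) (w : position K),
    (forall j, (elt j < e)%N -> w j = znew j) -> element_ok t w e ->
    distance2 e zold znew <= distance2 e zold w.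

Definition step (R : realType) (K : construction R) (v : variant)
    (o : orientation) (t0 : R) (z0 : position K) (eps del : R)
    (S S' : state K) : Prop :=
  if halted S then S' = S
  else S' = advance v o t0 z0 eps del S (pos S') /\
       chosen_by_proximity (time S') (pos S) (pos S').

(* [del k] is the angle of the [k]-th small step, and [eps k] the diameter of
   the circle if a new detour begins at that step (unused otherwise). *)
Definition run (R : realType) (K : construction R) (v : variant)
    (o : orientation) (t0 : R) (z0 : position K) (eps del : nat -> R)
    (E : nat -> state K) : Prop :=
  E 0%N = initial_state t0 z0 /\
  forall k, step v o t0 z0 (eps k) (del k) (E k) (E k.+1).

Definition locus (R : realType) (K : construction R) (v : variant)
    (E : nat -> state K) : set (R * R) :=
  [set p | exists k, hit v (time (E k)) (pos (E k)) /\
                     tracer (pos (E k)) = (p.1%:C, p.2%:C)].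

(* [Phi k theta] is the germ of the coordinate functions of the elements when
   the [k]-th step has covered the angle [theta]. *)
Definition follows_continuation (R : realType) (K : construction R)
    (o : orientation) (eps del : nat -> R) (E : nat -> state K)
    (Phi : nat -> R -> R[i] -> position K) : Prop :=
  (\forall u \near (time (E 0%N) : R[i]^o), instance u (Phi 0%N 0 u)) /\
  forall k, ~~ halted (E k) ->
    [/\ continuation (del k) (arc o (eps k) (E k)) (Phi k),
        Phi k 0 (time (E k)) =1 pos (E k),
        Phi k (del k) (time (E k.+1)) =1 pos (E k.+1) &
        \forall u \near (time (E k.+1) : R[i]^o),
          Phi k.+1 0 u =1 Phi k (del k) u].

Definition small_detours (R : realType) (K : construction R)
    (eps : nat -> R) (E : nat -> state K)
    (Phi : nat -> R -> R[i] -> position K) : Prop :=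
  forall k, ~~ halted (E k) -> fresh (E k) ->
    let ram := ramifies (detour_centre (eps k) (E k)) (eps k / 2)
                        (time (E k)) (Phi k 0) in
    (forall tau tau' P P', ram tau P -> ram tau' P' -> tau = tau') /\
    (forall tau P, ram tau P -> real_at_ramification P).

Definition no_real_position_missed (R : realType) (K : construction R)
    (v : variant) (o : orientation) (eps del : nat -> R) (E : nat -> state K)
    (Phi : nat -> R -> R[i] -> position K) : Prop :=
  forall k, ~~ halted (E k) -> forall theta, 0 < theta < del k ->
    let t := arc o (eps k) (E k) theta in ~~ hit v t (Phi k theta t).

Definition algorithm_assumptions (R : realType) (K : construction R)
    (v : variant) (o : orientation) (eps del : nat -> R)
    (E : nat -> state K) : Prop :=
  exists Phi, [/\ small_detours eps E Phi,
                  follows_continuation o eps del E Phi &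
                  no_real_position_missed v o eps del E Phi].

Definition irreducible2 (R : realType) (f : {poly {poly R}}) : Prop :=
  [/\ f != 0, f \isn't a GRing.unit &
      forall p q, f = p * q -> (p \is a GRing.unit) \/ (q \is a GRing.unit)].

Definition real_points (R : realType) (f : {poly {poly R}}) : set (R * R) :=
  [set p | f.[p.2%:P].[p.1] = 0].

(* Isolated real points count as components. *)
Definition has_real_component (R : realType) (f : {poly {poly R}}) : Prop :=
  exists2 p : R * R, real_points f p &
    connected_component (real_points f) p !=set0.

Definition locus_assumptions (R : realType) (L : set (R * R)) : Prop :=
  exists f : {poly {poly R}},
    [/\ L `<=` real_points f, irreducible2 f & has_real_component f].

(* Main.v *)
(* Complex conjugation carries the anticlockwise run to the clockwise one, as
   far as the tracer is concerned (the other elements need not be conjugate).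
   The equations of the construction are real, so conjugation permutes the
   branches at the real time [t0]. Those at which the tracer has its real
   initial position agree on the tracer near [t0], by non-singularity; hence
   the germ of the tracer at [t0] is its own conjugate. By uniqueness of
   analytic continuation along conjugate arcs the two tracers stay conjugate
   for ever, so they are real at the same steps, and then equal. *)
Require Import Defs.
From HB Require Import structures.
From mathcomp Require Import all_boot all_order all_algebra.
From mathcomp Require Import all_classical all_reals all_analysis.
From mathcomp Require Import complex.
From mathcomp Require mpoly.

Set Implicit Arguments.
Unset Strict Implicit.
Unset Printing Implicit Defensive.

Import Order.TTheory GRing.Theory Num.Theory.
Import numFieldNormedType.Exports.
Local Open Scope classical_set_scope.
Local Open Scope ring_scope.
Local Open Scope complex_scope.

(** * Power series over a numeric field: remainder estimate and isolated zeros *)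

Lemma near_distP (F : numFieldType) (p : F) (P : F -> Prop) :
  (\forall u \near (p : F^o), P u) <->
  exists2 e : F, 0 < e & forall u, `|u - p| < e -> P u.
Proof.
split.
  move/(nbhs_ballP (p : F^o)) => [e /= e0 eP]; exists e => // u ue.
  by apply: eP; rewrite /ball /= distrC.
move=> [e e0 eP]; apply/(nbhs_ballP (p : F^o)); exists e => //= u ue.
by apply: eP; rewrite distrC.
Qed.

Lemma geometric_sum_le2 (F : numFieldType) (q : F) n :
  0 <= q -> 2 * q <= 1 -> \sum_(0 <= k < n) q ^+ k <= 2.
Proof.
move=> q0 q1; elim: n => [|n IH]; first by rewrite big_geq.
rewrite big_nat_recl //=.
under eq_bigr do rewrite exprS.
rewrite -mulr_sumr expr0 (_ : 2 = 1 + 1 :> F) //.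
rewrite lerD2l; apply: le_trans q1; rewrite mulrC.
by apply: ler_wpM2r.
Qed.

Lemma cvg_seq_norm_bound (F : numFieldType) (a : nat -> F) :
  (a : nat -> F^o) @ \oo --> (0 : F^o) ->
  exists2 M : F, 0 <= M & forall k, `|a k| <= M.
Proof.
move=> /cvgr0_norm_le /(_ 1 ltr01) [N _ aN].
have S0 n : 0 <= \sum_(0 <= i < n) `|a i| by apply: sumr_ge0.
exists (1 + \sum_(0 <= i < N) `|a i|); first by rewrite addr_ge0.
move=> k; have [kN|Nk] := ltnP k N.
  rewrite (bigD1_seq k) /= ?mem_index_iota ?iota_uniq //.
  by rewrite addrCA lerDl addr_ge0 // sumr_ge0.
by apply: le_trans (aN k Nk) _; rewrite lerDl.
Qed.

(** Convergence at [p + r] bounds [c k * r ^+ k] by some [M]. On the disc of radius [r / 2] the tail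
    after index [m] is then dominated by a geometric series of ratio [q <= 1 / 2], whose sum
    contributes the factor 2. *)
Lemma power_series_remainder (F : numFieldType) (c : nat -> F) (f : F -> F)
    (p : F) (m : nat) :
  (\forall u \near (p : F^o),
    series (fun k => c k * (u - p) ^+ k : F^o) @ \oo --> (f u : F^o)) ->
  (forall k, (k < m)%N -> c k = 0) ->
  exists2 C, 0 <= C & \forall u \near (p : F^o),
    `|f u - c m * (u - p) ^+ m| <= C * `|u - p| ^+ m.+1.
Proof.
move=> /near_distP [e e0 fe] c0.
have [r r0 re] : exists2 r : F, 0 < r & r < e.
  by exists (e / 2); rewrite ?divr_gt0 // ltr_pdivrMr // ltr_pMr // ltr1n.
have [|M M0 cM] := @cvg_seq_norm_bound F (fun k => c k * r ^+ k).
  apply: cvg_series_cvg_0; apply/cvg_ex; exists (f (p + r)).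
  have := fe (p + r); rewrite addrAC subrr add0r gtr0_norm //; exact.
exists (2 * M / r ^+ m.+1).
  by rewrite divr_ge0 ?mulr_ge0 // exprn_ge0 // ltW.
apply/near_distP; exists (r / 2); first by rewrite divr_gt0.
move=> u ur; set x := u - p.
have xr : `|x| < r.
  by apply: lt_trans ur _; rewrite ltr_pdivrMr // ltr_pMr // ltr1n.
pose q := `|x| / r.
have q0 : 0 <= q by rewrite divr_ge0 // ltW.
have q1 : 2 * q <= 1.
  by rewrite mulrA ler_pdivrMr // mul1r mulrC -ler_pdivlMr // ltW.
apply/ler_addgt0Pr => d d0.
have /cvgr_dist_lt /(_ d d0) [N _ sN] := fe u (lt_trans xr re).
(* The partial sum must contain the term of index [m], which is subtracted below. *)
pose n := maxn N m.+1.
have /ltW fd := sN n (leq_maxl _ _).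
set s := series _ n in fd.
have -> : f u - c m * x ^+ m = (s - c m * x ^+ m) + (f u - s).
  by rewrite [RHS]addrC addrA subrK.
apply: le_trans (ler_normD _ _) _; apply: lerD => //.
have -> : s - c m * x ^+ m = \sum_(m.+1 <= k < n) c k * x ^+ k.
  rewrite /s /series /= (@big_cat_nat _ _ _ m) //=; last first.
    by rewrite ltnW // leq_max ltnSn orbT.
  rewrite big_nat_cond big1 ?add0r; last first.
    by move=> i /andP[/andP[_ im] _]; rewrite c0 // mul0r.
  by rewrite big_ltn ?leq_max ?ltnSn ?orbT // addrAC subrr add0r.
apply: le_trans (ler_norm_sum _ _ _) _.
have -> : 2 * M / r ^+ m.+1 * `|x| ^+ m.+1 = M * q ^+ m.+1 * 2.
  rewrite /q expr_div_n (mulrC 2) -!mulrA; congr (_ * _).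
  by rewrite mulrC [_^-1 * _]mulrC -mulrA.
apply: (@le_trans _ _ (\sum_(m.+1 <= k < n) M * q ^+ k)).
  apply: ler_sum => k _.
  have -> : `|c k * x ^+ k| = `|c k * r ^+ k| * q ^+ k.
    rewrite !normrM normrX /q expr_div_n -mulrA; congr (_ * _).
    rewrite (gtr0_norm (exprn_gt0 k r0)) mulrCA divff ?mulr1 //.
    by rewrite expf_neq0 // gt_eqF.
  by rewrite ler_wpM2r ?exprn_ge0.
rewrite -[m.+1 in X in X <= _]add0n big_addn.
under eq_bigr do rewrite exprD mulrA mulrAC.
rewrite -mulr_sumr ler_wpM2l ?mulr_ge0 ?exprn_ge0 //.
exact: geometric_sum_le2.
Qed.

(** If [c m] were the first nonzero coefficient, the remainder bound at a zero [u != p] would give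
    [|c m| <= C |u - p|], which fails for zeros close to [p]. *)
Lemma power_series_isolated_zeros (F : numFieldType) (c : nat -> F) (f : F -> F)
    (p : F) :
  (\forall u \near (p : F^o),
    series (fun k => c k * (u - p) ^+ k : F^o) @ \oo --> (f u : F^o)) ->
  (forall e : F, 0 < e -> exists u, [/\ `|u - p| < e, u != p & f u = 0]) ->
  forall k, c k = 0.
Proof.
move=> fp zeros; elim/ltn_ind => m c0.
have [C C0 /near_distP[e e0 fe]] := power_series_remainder fp c0.
apply/eqP/negP => /negP cm0.
have C1 : 0 < C + 1 by rewrite ltr_wpDl.
have d0 : 0 < `|c m| / (C + 1) by rewrite divr_gt0 ?normr_gt0.
(* Half the harmonic mean of [e] and [|c m| / (C + 1)]: positive and at most either of them. [C + 1]
   replaces [C], which may be 0. *)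
pose d := e * (`|c m| / (C + 1)) / (e + `|c m| / (C + 1)).
have ed0 : 0 < e + `|c m| / (C + 1) by rewrite addr_gt0.
have [|u [ud up fu]] := zeros d; first by rewrite divr_gt0 // mulr_gt0.
have ue : `|u - p| < e.
  apply: lt_le_trans ud _; rewrite ler_pdivrMr // mulrDr lerDr.
  by rewrite mulr_ge0 // ltW.
have uc : `|u - p| < `|c m| / (C + 1).
  apply: lt_le_trans ud _; rewrite ler_pdivrMr // mulrC mulrDr lerDl.
  by rewrite mulr_ge0 // ltW.
have x0 : 0 < `|u - p| by rewrite normr_gt0 subr_eq0.
have := fe u ue; rewrite fu sub0r normrN normrM normrX exprS mulrA.
rewrite ler_pM2r ?exprn_gt0 // => cx.
move: uc; rewrite ltr_pdivlMr // => uc.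
have := lt_le_trans uc cx; rewrite mulrDr mulr1 mulrC gtrDl.
by rewrite normr_lt0.
Qed.

(** * Conjugation, analytic functions and the identity theorem *)

Lemma dist_conjc (R : realType) (u v : R[i]) :
  `|u^*%C - v^*%C| = `|u - v|.
Proof. by rewrite -(raddfB (@conjc R)) normcJ. Qed.

Lemma near_conjc (R : realType) (p : R[i]) (P : R[i] -> Prop) :
  (\forall u \near (p^*%C : R[i]^o), P u) ->
  \forall u \near (p : R[i]^o), P u^*%C.
Proof.
move=> /near_distP [e e0 eP]; apply/near_distP; exists e => // u ue.
by apply: eP; rewrite dist_conjc.
Qed.

Lemma analytic_atB (R : realType) (f g : R[i] -> R[i]) (p : R[i]) :
  analytic_at f p -> analytic_at g p -> analytic_at (fun u => f u - g u) p.
Proof.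
move=> [c fc] [d gd]; exists (fun k => c k - d k).
apply: filterS2 fc gd => u fu gu.
have -> : series (fun k => (c k - d k) * (u - p) ^+ k : R[i]^o) =
    (fun n => series (fun k => c k * (u - p) ^+ k : R[i]^o) n -
              series (fun k => d k * (u - p) ^+ k : R[i]^o) n).
  apply/funext => n; rewrite /series /= -sumrB.
  by apply: eq_bigr => i _; rewrite mulrBl.
exact: cvgB.
Qed.

(** Schwarz reflection: conjugating the coefficients of the expansion of [f] conjugates its partial
    sums term by term, and conjugation preserves distances. *)
Lemma analytic_at_conjc (R : realType) (f : R[i] -> R[i]) (p : R[i]) :
  analytic_at f p^*%C -> analytic_at (fun u => (f u^*%C)^*%C) p.
Proof.
move=> [c fc]; exists (fun k => (c k)^*%C).
apply: filterS (near_conjc fc) => u.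
move=> fu; apply/cvgrPdist_lt => e e0.
move/cvgrPdist_lt: fu => /(_ e e0); apply: filterS => n.
suff -> : series (fun k => (c k)^*%C * (u - p) ^+ k : R[i]^o) n =
    (series (fun k => c k * (u^*%C - p^*%C) ^+ k : R[i]^o) n)^*%C.
  by rewrite dist_conjc.
rewrite /series /= rmorph_sum; apply: eq_bigr => i _.
by rewrite rmorphM rmorphXn rmorphB /= !conjcK.
Qed.

(** The remainder bound for [m = 0] reads [|f u - c 0| <= C |u - p|]; at [u = p] it gives
    [f p = c 0]. *)
Lemma analytic_at_continuous (R : realType) (f : R[i] -> R[i]) (p : R[i]) :
  analytic_at f p -> (f : R[i]^o -> R[i]^o) @ (p : R[i]^o) --> (f p : R[i]^o).
Proof.
move=> [c fc].
have [|C C0 /near_distP[d d0 fd]] := @power_series_remainder _ c f p 0 fc.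
  by [].

have fp : f p = c 0%N.
  have := fd p; rewrite subrr normr0 => /(_ d0).
  by rewrite !expr0 expr1 mulr0 mulr1 normr_le0 subr_eq0 => /eqP.
apply/(@cvgrPdistC_lt _ _ _ (nbhs (p : R[i]^o))) => e e0; apply/near_distP.
have C1 : 0 < C + 1 by rewrite ltr_wpDl.
have eC0 : 0 < e / (C + 1) by rewrite divr_gt0.
exists (d * (e / (C + 1)) / (d + e / (C + 1))).
  exact: divr_gt0 (mulr_gt0 d0 eC0) (addr_gt0 d0 eC0).
have h0 : 0 < d + e / (C + 1) by rewrite addr_gt0.
move=> u ur.
have ud : `|u - p| < d.
  apply: lt_le_trans ur _; rewrite ler_pdivrMr // mulrDr lerDr.
  by rewrite mulr_ge0 // ltW.
have ue : `|u - p| < e / (C + 1).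
  apply: lt_le_trans ur _; rewrite ler_pdivrMr // mulrC mulrDr lerDl.
  by rewrite mulr_ge0 // ltW.
have := fd u ud; rewrite fp expr0 mulr1 expr1 => /le_lt_trans; apply.
move: ue; rewrite ltr_pdivlMr // => /le_lt_trans; apply.
by rewrite mulrDr mulr1 mulrC lerDl.
Qed.

(** Accumulating zeros of [f - g] force all its coefficients to vanish, so its series has limit 0
    near [p]. *)
Lemma analytic_identity (R : realType) (f g : R[i] -> R[i]) (p : R[i]) :
  analytic_at f p -> analytic_at g p ->
  (forall e : R[i], 0 < e ->
     exists u, [/\ `|u - p| < e, u != p & f u = g u]) ->
  \forall u \near (p : R[i]^o), f u = g u.
Proof.
move=> fp gp zeros; have [c fgc] := analytic_atB fp gp.
have c0 : forall k, c k = 0.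
  apply: (power_series_isolated_zeros fgc) => e /zeros[u [ue up fgu]].
  by exists u; split => //; rewrite fgu subrr.
apply: filterS fgc => u; rewrite (_ : series _ = fun=> 0); last first.
  apply/funext => n; rewrite /series /= big1 // => i _.
  by rewrite c0 mul0r.
move=> /(cvg_unique (@norm_hausdorff _ _)) h.
by apply/eqP; rewrite -subr_eq0 -(h 0) //; exact: cvg_cst.
Qed.

(** * Uniqueness of analytic continuation along a path, one coordinate at a time *)

Definition scalar_continuation (R : realType) (L : R) (gamma : R -> R[i])
    (f : R -> R[i] -> R[i]) : Prop :=
  forall s, 0 <= s <= L ->
    analytic_at (f s) (gamma s) /\
    (\forall s' \near s, 0 <= s' <= L ->
      \forall u \near (gamma s' : R[i]^o), f s' u = f s u).

(** The parameters at which both germs agree form a nonempty subset of [[0, L]], open because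
    neighbouring germs agree and closed by the identity theorem; the segment is connected. *)
Lemma continuation_unique (R : realType) (L : R) (gamma : R -> R[i])
    (f g : R -> R[i] -> R[i]) :
  0 <= L -> continuous (gamma : R -> R[i]^o) ->
  scalar_continuation L gamma f -> scalar_continuation L gamma g ->
  (\forall u \near (gamma 0 : R[i]^o), f 0 u = g 0 u) ->
  \forall u \near (gamma L : R[i]^o), f L u = g L u.
Proof.
move=> L0 gammaC cf cg fg0.
pose good s := \forall u \near (gamma s : R[i]^o), f s u = g s u.
have good_open s : 0 <= s <= L -> good s ->
    \forall s' \near s, 0 <= s' <= L -> good s'.
  move=> sL gs; have [_ fs] := cf s sL; have [_ hs] := cg s sL.
  have gs' : \forall s' \near s,
      \forall u \near (gamma s' : R[i]^o), f s u = g s u.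
    exact: (gammaC s _ (near_join gs)).
  near=> s' => s'L.
  have fs' : \forall u \near (gamma s' : R[i]^o), f s' u = f s u.
    by move: s'L; near: s'.
  have hs' : \forall u \near (gamma s' : R[i]^o), g s' u = g s u.
    by move: s'L; near: s'.
  have gs1 : \forall u \near (gamma s' : R[i]^o), f s u = g s u.
    by near: s'.
  by apply: filterS3 fs' hs' gs1 => u -> ->.
have good_closed s : 0 <= s <= L ->
    closure [set s' | 0 <= s' <= L /\ good s'] s -> good s.
  move=> sL cs; have [fa fs] := cf s sL; have [ga hs] := cg s sL.
  (* A good [s'] close to [s] makes [f s] and [g s] agree around [gamma s']; [P] is the closeness
     still to be prescribed. *)
  have near_s (P : R -> Prop) : (\forall s' \near s, P s') ->
      exists s', [/\ P s', f s (gamma s') = g s (gamma s') &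
        gamma s' = gamma s -> good s].
    move=> Ps.
    have [s' [[s'L gs'] [[fs' hs'] Ps']]] := cs _ (filterI (filterI fs hs) Ps).
    have fgs : \forall u \near (gamma s' : R[i]^o), f s u = g s u.
      by apply: filterS3 (fs' s'L) (hs' s'L) gs' => u -> ->.
    exists s'; split; [exact: Ps' | exact: nbhs_singleton fgs |].
    by move=> e; rewrite /good -e.
  (* Either [gamma] returns to [gamma s] at a nearby good time, and then [s] is
     good, or the points [gamma s'] are zeros of [f s - g s] that accumulate
     at, but differ from, [gamma s]. *)
  have [//|ngood] := pselect (good s).
  apply: (analytic_identity fa ga) => e e0.
  have [|s' [s'e fgs' ns']] := near_s (fun s' => `|gamma s' - gamma s| < e).
    exact: (@cvgr_distC_lt _ _ _ _ _ _ _ (gammaC s) _ e0).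
  exists (gamma s'); split; [exact: s'e | by apply/eqP => /ns' | exact: fgs'].
pose A := `[0, L]%classic : set R.
have AE s : A s <-> 0 <= s <= L by rewrite /A /= in_itv.
have eqA : A `&` good = A.
  apply: (segment_connected (a := 0) (b := L)).
  - by exists 0; split; [apply/AE; rewrite lexx | exact: fg0].
  - exists (interior [set s | 0 <= s <= L -> good s]).
      exact: open_interior.
    apply/seteqP; split => s [/AE sL gs]; (split; first exact/AE).
      exact: good_open.
    exact: (interior_subset gs).
  - exists (closure [set s' | 0 <= s' <= L /\ good s']).
      exact: closed_closure.
    apply/seteqP; split => s [/AE sL gs]; (split; first exact/AE).
      by apply: subset_closure; split.
    exact: good_closed.
have : A L by apply/AE; rewrite L0 lexx.
by rewrite -eqA => -[].
Unshelve. all: by end_near. Qed.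

(** * Conjugate instances, and continuity of the detour arcs *)

(** The parameterization of the mover and the equations have real coefficients, so evaluating them
    commutes with conjugation. *)
Lemma instance_conjc (R : realType) (K : construction R) (t : R[i])
    (z : position K) :
  instance t z -> instance t^*%C (fun j => (z j)^*%C).
Proof.
have evalJ (p : {poly R}) : evalC p t^*%C = (evalC p t)^*%C.
  rewrite /evalC -horner_map /=; congr (_.[_]).
  by rewrite -map_poly_comp; apply: eq_map_poly => x /=; rewrite oppr0.
move=> tz e; have := tz e; rewrite /element_ok; case: ifP => _.
  move=> H j /H [d0 ->]; rewrite !evalJ conjc_eq0; split => //.
  by rewrite rmorphM /= conjc_inv.
move=> H p /H p0; rewrite -[RHS]conjc0 -p0 /mpoly.mmap rmorph_sum.
apply: eq_bigr => m _; rewrite rmorphM /= oppr0; congr (_ * _).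
rewrite /mpoly.mmap1 rmorph_prod; apply: eq_bigr => i _.
by rewrite rmorphXn.
Qed.

Lemma real_complex_continuous (R : realType) :
  continuous (fun x : R => x%:C : R[i]^o).
Proof.
move=> x; apply/(@cvgrPdist_lt _ _ _ (nbhs x)); case=> e e'.
(* A positive element of [R[i]] has imaginary part 0, so the bound is a real one. *)
rewrite ltcE /= => /andP[/eqP -> e0]; near=> y.
rewrite -rmorphB /= normc_def /= expr0n /= addr0 sqrtr_sqr ltcR.
near: y; exact: cvgr_dist_lt.
Unshelve. all: by end_near. Qed.

Lemma unit_rotation_continuous (R : realType) (o : orientation) :
  continuous (unit_rotation o : R -> R[i]^o).
Proof.
pose s : R[i] := if o is Anticlockwise then 'i else - 'i.
have -> : unit_rotation o = fun x : R => (cos x)%:C + s * (sin x)%:C :> R[i]^o.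
  apply/funext => x; rewrite /s; case: o {s}; apply/eqP;
  rewrite eq_complex /=; simpc; rewrite ?mul0r ?mul1r ?addr0 ?add0r ?subr0 ?oppr0;
  by rewrite ?eqxx.
move=> x; apply: cvgD.
  apply: (cvg_comp cos (real_complex R)); first exact: continuous_cos.
  exact: real_complex_continuous.
apply: cvgM; first exact: cvg_cst.
apply: (cvg_comp sin (real_complex R)); first exact: continuous_sin.
exact: real_complex_continuous.
Qed.

Lemma arc_continuous (R : realType) (K : construction R) (o : orientation)
    (eps : R) (S : state K) : continuous (Defs.arc o eps S : R -> R[i]^o).
Proof.
move=> x; apply: cvgD; first exact: cvg_cst.
apply: cvgM; first exact: cvg_cst.
exact: unit_rotation_continuous.
Qed.

(** * Germs of an element at a non-singular time *)

Definition conj_position (R : realType) (K : construction R) (z : position K) :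
  position K := fun j => (z j)^*%C.

(** Near [t] the values of [F] and [G] lie on finitely many branches, a priori depending on the time
    [u]. Two branches with the same [e] at [t] agree on [e] nearby; any other pair cannot carry
    [F u] and [G u] for [u] close to [t]. *)
Lemma element_germ_unique (R : realType) (K : construction R)
    (e : 'I_(nelt K)) (t : R[i]) (F G : R[i] -> position K) :
  nonsingular K t ->
  (\forall u \near (t : R[i]^o), instance u (F u)) ->
  (\forall u \near (t : R[i]^o), instance u (G u)) ->
  (forall j, analytic_at (fun u => F u j) t) ->
  (forall j, analytic_at (fun u => G u j) t) ->
  eq_element e (F t) (G t) ->
  \forall u \near (t : R[i]^o), eq_element e (F u) (G u).
Proof.
move=> [m [phi [phi_an phi_inst phi_sep]]] FI GI FA GA FGt.
have branches (k l : 'I_m) : \forall u \near (t : R[i]^o),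
    F u =1 phi k u -> G u =1 phi l u -> eq_element e (F u) (G u).
  have [/phi_sep|] := pselect (eq_element e (phi k t) (phi l t)).
    by apply: filterS => u kl Fk Gl j je; rewrite Fk Gl kl.
  move=> /existsNP[j /not_implyP[je kl]].
  (* Branches whose positions of [e] differ at [t] are kept apart by the
     continuity of [F], [G], [phi k] and [phi l]. *)
  have h := analytic_at_continuous
    (analytic_atB (analytic_atB (FA j) (phi_an k j))
                  (analytic_atB (GA j) (phi_an l j))).
  have h0 : F t j - phi k t j - (G t j - phi l t j) != 0.
    rewrite (FGt j je) opprB addrC addrA subrK subr_eq0.
    by apply/eqP => lk; apply: kl.
  have {}h0 : \forall u \near (t : R[i]^o),
      F u j - phi k u j - (G u j - phi l u j) != 0 by exact: cvgr_neq0 h h0.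
  by apply: filterS h0 => u /eqP Fu Fk Gl; case: Fu; rewrite Fk Gl !subrr.
(* There are finitely many pairs of branches, so one neighbourhood serves them all. *)
have all_branches : \forall u \near (t : R[i]^o), forall k l : 'I_m,
    F u =1 phi k u -> G u =1 phi l u -> eq_element e (F u) (G u).
  have bk k := filter_forall (nbhs_filter _) (branches k).
  exact: filter_forall (nbhs_filter _) bk.
apply: filterS (filterI (filterI FI GI) (filterI phi_inst all_branches)).
move=> u [[Fi Gi] [phi_u br]].
have [k Fk] := (phi_u (F u)).1 Fi; have [l Gl] := (phi_u (G u)).1 Gi.
exact: br Fk Gl.
Qed.

(** Since [t] is real, conjugating both the argument and the value of [G] gives again an analytic
    family of instances near [t], to which uniqueness of germs applies. *)
Lemma element_germ_conjc (R : realType) (K : construction R)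
    (e : 'I_(nelt K)) (t : R) (F G : R[i] -> position K) :
  nonsingular K t%:C ->
  (\forall u \near (t%:C : R[i]^o), instance u (F u)) ->
  (\forall u \near (t%:C : R[i]^o), instance u (G u)) ->
  (forall j, analytic_at (fun u => F u j) t%:C) ->
  (forall j, analytic_at (fun u => G u j) t%:C) ->
  eq_element e (F t%:C) (conj_position (G t%:C)) ->
  \forall u \near (t%:C : R[i]^o), eq_element e (F u) (conj_position (G u^*%C)).
Proof.
move=> nt FI GI FA GA FGt; have tJ : (t%:C)^*%C = t%:C := conjc_real t.
have GIJ : \forall u \near (t%:C : R[i]^o),
    instance u (conj_position (G u^*%C)).
  rewrite -tJ in GI; apply: filterS (near_conjc GI) => u /instance_conjc.
  by rewrite conjcK.
have GAJ j : analytic_at (fun u => conj_position (G u^*%C) j) t%:C.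
  by apply: (@analytic_at_conjc _ (fun u => G u j)); rewrite tJ.
by apply: (element_germ_unique nt FI GIJ FA GAJ); rewrite tJ.
Qed.

(** * Conjugate states of the algorithm *)

(** The invariant of the two runs. Positions are compared on the tracer alone, because [z0] is
    assumed real only there. *)
Definition conj_state (R : realType) (K : construction R) (S S' : state K) :
    Prop :=
  [/\ [/\ time S' = (time S)^*%C, dir S' = (dir S)^*%C,
          centre S' = (centre S)^*%C & origin S' = (origin S)^*%C],
      fresh S' = fresh S, halted S' = halted S &
      eq_element (elt (xc K)) (pos S') (conj_position (pos S))].

Lemma conjc_is_real (R : realType) (x : R[i]) :
  (x^*%C \is Num.real) = (x \is Num.real).
Proof. by case: x => a b; rewrite !realE !lecE /= !(eq_sym 0) oppr_eq0. Qed.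

Lemma real_conjc (R : realType) (x : R[i]) : x \is Num.real -> x^*%C = x.
Proof.
by case: x => a b; rewrite realE !lecE /= (eq_sym 0) => /orP[]/andP[/eqP-> _];
  rewrite oppr0.
Qed.

Section ConjugateStates.
Variables (R : realType) (K : construction R).
Implicit Types (S : state K) (z : position K).

Lemma tracer_conjc z z' :
  eq_element (elt (xc K)) z' (conj_position z) ->
  tracer z' = ((tracer z).1^*%C, (tracer z).2^*%C).
Proof.
move=> zz'; rewrite /tracer /=; congr pair; first exact: zz'.
by apply: zz'; apply/tracer_coords; right.
Qed.

Lemma hit_conjc v t z z' :
  eq_element (elt (xc K)) z' (conj_position z) ->
  hit v t^*%C z' = hit v t z.
Proof.
by move=> /tracer_conjc zz'; rewrite /hit /tracer_real zz' /= !conjc_is_real.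
Qed.

Lemma new_dir_conjc v (s t a b : R[i]) :
  new_dir v s^*%C t^*%C a^*%C b^*%C = (new_dir v s t a b)^*%C.
Proof.
case: v => /=.
  rewrite (inj_eq (can_inj (@conjcK R))); case: ifP => // _.
  by rewrite rmorphN.
have normV_conjc (x : R[i]) : (`|x|^-1)^*%C = `|x|^-1.
  by rewrite conjc_inv normc_def conjc_real.
rewrite dist_conjc -{1}normV_conjc.
by rewrite -(raddfB (@conjc R)) -(rmorphM (@conjc R)).
Qed.

Lemma detour_centre_conjc eps S S' :
  conj_state S S' -> detour_centre eps S' = (detour_centre eps S)^*%C.
Proof.
move=> [[t d c _] f _ _]; rewrite /detour_centre f t d c; case: ifP => // _.
rewrite -{1}[(eps / 2)%:C]conjc_real.
by rewrite -(rmorphM (@conjc R)) -(raddfD (@conjc R)).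
Qed.

(** The clockwise unit rotation is by definition the conjugate of the anticlockwise one. *)
Lemma arc_conjc eps S S' theta :
  conj_state S S' ->
  Defs.arc Clockwise eps S' theta = (Defs.arc Anticlockwise eps S theta)^*%C.
Proof.
move=> SS'; have [[t _ _ _] _ _ _] := SS'.
by rewrite /Defs.arc (detour_centre_conjc _ SS') t rmorphD rmorphM rmorphB.
Qed.

Lemma arc0 o eps S : Defs.arc o eps S 0 = time S.
Proof.
rewrite /Defs.arc (_ : unit_rotation o 0 = 1) ?mulr1 1?addrC ?subrK //.
by case: o; rewrite /= cos0 sin0 ?oppr0.
Qed.

(** Every test of a step has the same outcome in both runs: reality is invariant under conjugation,
    and an equality is tested either between two conjugated values or against one fixed by
    conjugation, namely [t0], 1 or the real tracer of [z0]. *)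
Lemma advance_conjc v t0 z0 eps del S S' z z' :
  tracer_real z0 -> conj_state S S' ->
  eq_element (elt (xc K)) z' (conj_position z) ->
  conj_state (advance v Anticlockwise t0 z0 eps del S z)
             (advance v Clockwise t0 z0 eps del S' z').
Proof.
move=> z0R SS' zz'; have [[t d c o] f h _] := SS'.
have oJ : detour_origin S' = (detour_origin S)^*%C.
  by rewrite /detour_origin f t o; case: ifP.
rewrite /advance (arc_conjc _ _ SS') (detour_centre_conjc _ SS') oJ.
rewrite (hit_conjc _ _ zz') d new_dir_conjc.
set T := Defs.arc _ _ _ _; set s := new_dir _ _ _ _ _.
have -> : (if hit v T z then s^*%C else (dir S)^*%C) =
          (if hit v T z then s else dir S)^*%C by case: ifP.
have eqJ (x y : R[i]) : y^*%C = y -> (x^*%C == y) = (x == y).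
  by move=> {1}<-; rewrite (inj_eq (can_inj (@conjcK R))).
split => //=; rewrite eqJ ?conjc_real // eqJ ?conjc1 //.
congr [&& _, _, _ & _]; rewrite (tracer_conjc zz').
case/andP: z0R; rewrite /tracer /= => /real_conjc xR /real_conjc yR.
by rewrite /eq_op /= !eqJ.
Qed.

End ConjugateStates.

(** * Induction along the two runs *)

(** Reflecting a continuation along the anticlockwise arc gives one along the clockwise arc, so
    agreement of the germs at angle 0 persists to angle [del]. *)
Lemma conj_continuation (R : realType) (K : construction R) (eps del : R)
    (S S' : state K) (Phi Phi' : R -> R[i] -> position K) j :
  0 <= del -> conj_state S S' ->
  continuation del (Defs.arc Anticlockwise eps S) Phi ->
  continuation del (Defs.arc Clockwise eps S') Phi' ->
  (\forall u \near (time S' : R[i]^o), Phi' 0 u j = (Phi 0 u^*%C j)^*%C) ->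
  \forall u \near (Defs.arc Clockwise eps S' del : R[i]^o),
    Phi' del u j = (Phi del u^*%C j)^*%C.
Proof.
move=> del0 SS' cPhi cPhi' germ0.
apply: (@continuation_unique R del (Defs.arc Clockwise eps S')
  (fun s u => Phi' s u j) (fun s u => (Phi s u^*%C j)^*%C)).
- exact: del0.
- exact: arc_continuous.
- move=> s /cPhi'[an nb]; split; first exact: an.
  by apply: filterS nb => s' h /h; apply: filterS => u ->.
- move=> s /cPhi[an nb]; split.
    apply: (@analytic_at_conjc _ (fun u => Phi s u j)).
    by rewrite (arc_conjc _ _ SS') conjcK.
  apply: filterS nb => s' h /h {}h.
  rewrite (arc_conjc _ _ SS').
  rewrite -[Defs.arc Anticlockwise _ _ _]conjcK in h.
  by apply: filterS (near_conjc h) => u ->.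
- by rewrite arc0.
Qed.

Section ConjugateRuns.
Variables (R : realType) (K : construction R) (v : variant) (t0 : R).
Variables (z0 : position K) (eps del : nat -> R) (E E' : nat -> state K).
Variables (Phi Phi' : nat -> R -> R[i] -> position K).
Hypothesis t0_nonsingular : nonsingular K t0%:C.
Hypothesis z0_real : tracer_real z0.
Hypothesis del_gt0 : forall k, 0 < del k.
Hypothesis run_E : run v Anticlockwise t0 z0 eps del E.
Hypothesis run_E' : run v Clockwise t0 z0 eps del E'.
Hypothesis follows_E : follows_continuation Anticlockwise eps del E Phi.
Hypothesis follows_E' : follows_continuation Clockwise eps del E' Phi'.

(** The induction carries germs, since a value alone does not determine an analytic continuation. *)
Definition conj_tracer_germ k := forall j, elt j = elt (xc K) ->
  \forall u \near (time (E' k) : R[i]^o),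
    Phi' k 0 u j = (Phi k 0 u^*%C j)^*%C.

Lemma initial_tracer_real j : elt j = elt (xc K) -> (z0 j)^*%C = z0 j.
Proof.
move: z0_real => /andP[xR yR].
by move=> /tracer_coords[] ->; apply: real_conjc.
Qed.

(** Both tracers start at the same real position at the real time [t0], so non-singularity makes
    their germs conjugate there. *)
Lemma conj_initial : conj_state (E 0%N) (E' 0%N) /\ conj_tracer_germ 0.
Proof.
have [E0 _] := run_E; have [E'0 _] := run_E'; split.
  rewrite E0 E'0; split => //.
    by split; symmetry; [exact: conjc_real | exact: conjc1 | exact: conjc_real..].
  by move=> j /initial_tracer_real.
have [inst /(_ 0%N)] := follows_E; have [inst' /(_ 0%N)] := follows_E'.
rewrite /conj_tracer_germ; move: inst inst'; rewrite E0 E'0 /=.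
move=> inst inst' /(_ isT)[cont' pos0' _ _] /(_ isT)[cont pos0 _ _] j je.
have r0 : 0 <= (0 : R) <= del 0%N by rewrite lexx ltW.
have [an _] := cont 0 r0; have [an' _] := cont' 0 r0.
rewrite !arc0 /= in an an'.
have := @element_germ_conjc R K (elt (xc K)) t0 _ _ t0_nonsingular
  inst' inst an' an.
case; last by move=> r r_gt0 h; exists r => // u /h; apply.
by move=> i ie; rewrite pos0' /conj_position pos0 initial_tracer_real.
Qed.

(** Conjugate germs at the start of a step stay conjugate to its end; their values at the new time
    are the new tracer positions. Germs are followed only until the run halts, after which the state
    is constant. *)
Lemma conj_step k :
  conj_state (E k) (E' k) -> (~~ halted (E k) -> conj_tracer_germ k) ->
  conj_state (E k.+1) (E' k.+1) /\
  (~~ halted (E k.+1) -> conj_tracer_germ k.+1).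
Proof.
move=> SS' germ_k; have [_ _ hh _] := SS'.
have := proj2 run_E k; have := proj2 run_E' k; rewrite /step hh.
case: ifPn => [h -> -> | nh [EQ' _] [EQ _]].
  by split; [exact: SS' | rewrite h].
have [cont _ pos1 glue] := proj2 follows_E k nh.
have nh' : ~~ halted (E' k) by rewrite hh.
have [cont' _ pos1' glue'] := proj2 follows_E' k nh'.
have time1 : time (E k.+1) = Defs.arc Anticlockwise (eps k) (E k) (del k).
  by rewrite EQ.
have time1' : time (E' k.+1) = Defs.arc Clockwise (eps k) (E' k) (del k).
  by rewrite EQ'.
have time1J : time (E' k.+1) = (time (E k.+1))^*%C.
  by rewrite time1' time1 (arc_conjc _ _ SS').
have germ1 j : elt j = elt (xc K) -> \forall u \near (time (E' k.+1) : R[i]^o),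
    Phi' k (del k) u j = (Phi k (del k) u^*%C j)^*%C.
  move=> je; rewrite time1'; apply: conj_continuation SS' cont cont' _.
    exact: ltW.
  exact: germ_k.
have pos1J : eq_element (elt (xc K)) (pos (E' k.+1))
    (conj_position (pos (E k.+1))).
  move=> j je; rewrite -pos1' /conj_position -pos1.
  by have /= -> := nbhs_singleton (germ1 j je); rewrite time1J conjcK.
split; first by rewrite EQ EQ'; exact: advance_conjc.
move=> _ j je; move: glue; rewrite -[time (E k.+1)]conjcK -time1J => glue.
(* In each run the germ that opens the next step is the one that closes this step. *)
by apply: filterS3 (near_conjc glue) glue' (germ1 j je) => u -> ->.
Qed.

Lemma conj_runs k : conj_state (E k) (E' k).
Proof.
suff [] : conj_state (E k) (E' k) /\
    (~~ halted (E k) -> conj_tracer_germ k) by [].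
elim: k => [|k [SS' germ_k]]; last exact: conj_step.
by have [? ?] := conj_initial.
Qed.

(** A recorded tracer position is real, hence equal to its conjugate, so the same index [k]
    witnesses the point in both loci. *)
Lemma conj_runs_locus : locus v E = locus v E'.
Proof.
apply/seteqP; split => p [k [hk tk]]; exists k;
  have [[tJ _ _ _] _ _ posJ] := conj_runs k.
  rewrite tJ (hit_conjc _ _ posJ) (tracer_conjc posJ) tk /=.
  by split; [exact: hk | rewrite !oppr0].
rewrite tJ (hit_conjc _ _ posJ) in hk; split; first exact: hk.
move: tk; rewrite (tracer_conjc posJ) => -[x y].
rewrite [LHS]surjective_pairing -[_.1]conjcK -[_.2]conjcK x y.
by rewrite !conjc_real.
Qed.

End ConjugateRuns.

Theorem theorem3p6 (R : realType) (K : construction R) (v : variant)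
    (t0 : R) (z0 : position K) (eps del : nat -> R) (E E' : nat -> state K)
    (K_alg : tracer_algebraic K)
    (t0_nonsingular : nonsingular K t0%:C)
    (z0_instance : instance t0%:C z0)
    (z0_real : tracer_real z0)
    (eps_gt0 : forall k, 0 < eps k)
    (del_gt0 : forall k, 0 < del k)
    (run_anti : run v Anticlockwise t0 z0 eps del E)
    (run_clock : run v Clockwise t0 z0 eps del E')
    (alg_anti : algorithm_assumptions v Anticlockwise eps del E)
    (alg_clock : algorithm_assumptions v Clockwise eps del E')
    (locus_anti : locus_assumptions (locus v E))
    (locus_clock : locus_assumptions (locus v E')) :
  locus v E = locus v E'.
Proof.
have [Phi [_ follows _]] := alg_anti; have [Phi' [_ follows' _]] := alg_clock.
exact: (conj_runs_locus t0_nonsingular z0_real del_gt0 run_anti run_clock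
  follows follows').
Qed.
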